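(* Let $r,s$ be positive integers, let $a_1,\dots,a_r,b_1,\dots,b_s,\alpha,\beta,z$ be as in the context, and let $w$ be the transform variable. Then the $q$-Sumudu transform of the ${}_rR_{s,q}$ function is given by $$\mathfrak{S}_q\left[t^{\beta-1}\,{}_rR_{s,q}(a_1,\dots,a_r;b_1,\dots,b_s;\alpha,\beta;zt^\alpha);w\right]=w^{\beta-1}(1-q)^{\beta-1}\,{}_r\Phi_s\left(a_1,\dots,a_r;b_1,\dots,b_s;z(1-q)^\alpha w^{\alpha}\right),$$ where $\mathfrak{S}_q$ is the $q$-Sumudu transform $$\mathfrak{S}_q\{f(t);w\}=\frac{1}{(1-q)w}\int_0^wf(t)\left(\tfrac{qt}{w};q\right)_\infty\mathrm{d}_qt=\frac1{1-q}\int_0^1f(wt)\,(qt;q)_\infty\,\mathrm{d}_qt,$$ $$\mathfrak{S}_q\{t^{\lambda-1};w\}=w^{\lambda-1}(1-q)^{\lambda-1}\Gamma_q(\lambda)\qquad(w\in(-\tau_1,\tau_2)),$$ over the set of functions $$A=\left\{f(t):\ \exists\, M,\tau_1,\tau_2>0,\ |f(t)|<M\,E_q\!\left(\tfrac{|t|}{\tau_j}\right),\ t\in(-1)^j\times[0,\infty)\right\}.$$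
   Context: Let $q\in\mathbb{C}$, $0<|q|<1$; complex powers are formed with fixed branches. $(a;q)_0=1$, $(a;q)_n=\prod_{i=0}^{n-1}(1-aq^i)$ for $n\ge1$, $(a;q)_\infty=\prod_{i\ge0}(1-aq^i)$. $\Gamma_q(x)=\frac{(q;q)_\infty}{(q^x;q)_\infty}(1-q)^{1-x}$, with $1/\Gamma_q(x)$ read as $0$ at its poles. In the definition of $A$, $j=1,2$ and $E_q(t)=\sum_{n\ge0}\frac{q^{n(n-1)/2}}{[n]_q!}t^n$ with $[n]_q!=\prod_{k=1}^n\frac{1-q^k}{1-q}$. For complex parameters the basic function ${}_rR_{s,q}$ and the basic hypergeometric function ${}_r\Phi_s$ are $${}_rR_{s,q}(a_1,\dots,a_r;b_1,\dots,b_s;\alpha,\beta;z)=\sum_{\ell=0}^\infty\frac{z^\ell(-1)^{(1+s-r)\ell}q^{(1+s-r)\binom{\ell}{2}}}{(q;q)_\ell\,\Gamma_q(\ell\alpha+\beta)}\,\frac{\prod_{i=1}^r(a_i;q)_\ell}{\prod_{j=1}^s(b_j;q)_\ell},$$ $${}_r\Phi_s(a_1,\dots,a_r;b_1,\dots,b_s;z)=\sum_{\ell=0}^\infty\frac{z^\ell}{(q;q)_\ell}\frac{\prod_{i=1}^r(a_i;q)_\ell}{\prod_{j=1}^s(b_j;q)_\ell}\left[(-1)^\ell q^{\binom{\ell}{2}}\right]^{1+s-r}.$$ Standing assumption: $a_iq^\ell\ne1$ and $b_jq^\ell\neq1$ for all $i,j$ and all integers $\ell\ge0$. The Jackson integral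 is $\int_0^xf(t)\,\mathrm{d}_qt=(1-q)x\sum_{n\ge0}q^nf(xq^n)$.
   Formalization: Proved for w≠0, |q^{lα+β}|<1 for all l≥0 (else false, e.g. α=−1, β=1), a convergent Φ series, and branches with (wq^n)^x=w^x(q^x)^n; the power rule assumes |q^λ|<1. *)

(* Defs.v *)
From Stdlib Require Import Reals Lra Lia ZArith.
From Coquelicot Require Import Coquelicot.
Open Scope C_scope.

(** Meaningful for convergent sequences and series only; statements pair
    these total operators with explicit convergence claims. *)
Definition CLim (u : nat -> C) : C :=
  (real (Lim_seq (fun n => fst (u n))), real (Lim_seq (fun n => snd (u n)))).

Definition CSeries (u : nat -> C) : C :=
  (Series (fun n => fst (u n)), Series (fun n => snd (u n))).

Definition Cconverges (u : nat -> C) : Prop :=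
  @ex_series C_AbsRing C_NormedModule u.

Fixpoint Cprod (f : nat -> C) (n : nat) : C :=
  match n with
  | O => 1
  | S m => Cprod f m * f m
  end.

Definition Czpow (x : C) (k : Z) : C :=
  match k with
  | Z0 => 1
  | Zpos p => x ^ Pos.to_nat p
  | Zneg p => / (x ^ Pos.to_nat p)
  end.

Definition Cexp (x : C) : C :=
  (exp (fst x) * cos (snd x), exp (fst x) * sin (snd x))%R.

(** A choice of logarithm at every nonzero point; no continuity is asked, so
    any placement of the branch cut (straight, spiral, ...) is allowed. *)
Definition log_branch (Lg : C -> C) : Prop :=
  forall u : C, u <> 0 -> Cexp (Lg u) = u.

(** The power u^x formed with the branch [Lg]; irrelevant at u = 0. *)
Definition cpow (Lg : C -> C) (u x : C) : C := Cexp (x * Lg u).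

(** The branch is fixed along the lattice w, wq, wq^2, ..., that is,
    (w q^n)^x = w^x (q^x)^n for all x.  The principal branch has this
    property for every w when 0 < q < 1; for general q it can fail for the
    principal branch, and one has to cut the plane along a spiral. *)
Definition branch_on_lattice (Lg : C -> C) (q w : C) : Prop :=
  forall n : nat, Lg (w * q ^ n) = Lg w + INR n * Lg q.

Definition qpoch (a q : C) (n : nat) : C := Cprod (fun i => 1 - a * q ^ i) n.

Definition qpoch_inf (a q : C) : C := CLim (qpoch a q).

Definition qGamma (Lg : C -> C) (q x : C) : C :=
  qpoch_inf q q / qpoch_inf (cpow Lg q x) q * cpow Lg (1 - q) (1 - x).

(** Since [/ 0 = 0], the expression [/ qGamma Lg q x] is 0 at the poles of
    the q-gamma function, which is the intended reading of 1/Gamma_q there. *)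
Lemma inv_qGamma_pole (Lg : C -> C) (q x : C) :
  qpoch_inf (cpow Lg q x) q = 0 -> / qGamma Lg q x = 0.
Proof.
  intros H.
  assert (H0 : / 0 = 0).
  { unfold Cinv, RtoC; simpl; f_equal; unfold Rdiv; ring. }
  unfold qGamma, Cdiv; rewrite H, H0, Cmult_0_r, Cmult_0_l; exact H0.
Qed.

Definition qfact (q : C) (n : nat) : C :=
  Cprod (fun k => (1 - q ^ S k) / (1 - q)) n.

Definition qExp (q t : C) : C :=
  CSeries (fun n => q ^ (n * (n - 1) / 2) / qfact q n * t ^ n).

(** [1 + s - r], possibly negative. *)
Definition excess (r s : nat) : Z := (1 + Z.of_nat s - Z.of_nat r)%Z.

(** Only the parameters [a 0, ..., a (r-1)] and [b 0, ..., b (s-1)] are used. *)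
Definition pochratio (q : C) (r s : nat) (a b : nat -> C) (l : nat) : C :=
  Cprod (fun i => qpoch (a i) q l) r / Cprod (fun j => qpoch (b j) q l) s.

Definition Rq_term (Lg : C -> C) (q : C) (r s : nat) (a b : nat -> C)
    (alpha beta z : C) (l : nat) : C :=
  z ^ l
  * Czpow (-1) (excess r s * Z.of_nat l)
  * Czpow q (excess r s * Z.of_nat (l * (l - 1) / 2))
  * / qpoch q q l * / qGamma Lg q (INR l * alpha + beta)
  * pochratio q r s a b l.

Definition Rq (Lg : C -> C) (q : C) (r s : nat) (a b : nat -> C)
    (alpha beta z : C) : C :=
  CSeries (Rq_term Lg q r s a b alpha beta z).

Definition Phi_term (q : C) (r s : nat) (a b : nat -> C) (z : C) (l : nat) : C :=
  z ^ l / qpoch q q l * pochratio q r s a b l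
  * Czpow ((-1) ^ l * q ^ (l * (l - 1) / 2)) (excess r s).

Definition Phi (q : C) (r s : nat) (a b : nat -> C) (z : C) : C :=
  CSeries (Phi_term q r s a b z).

Definition jackson_term (q : C) (f : C -> C) (x : C) (n : nat) : C :=
  q ^ n * f (x * q ^ n).

Definition jackson (q : C) (f : C -> C) (x : C) : C :=
  (1 - q) * x * CSeries (jackson_term q f x).

Definition sumudu_integrand (q : C) (f : C -> C) (w t : C) : C :=
  f t * qpoch_inf (q * t / w) q.

Definition sumudu_converges (q : C) (f : C -> C) (w : C) : Prop :=
  Cconverges (jackson_term q (sumudu_integrand q f w) w).

Definition sumudu (q : C) (f : C -> C) (w : C) : C :=
  / ((1 - q) * w) * jackson q (sumudu_integrand q f w) w.

(** The class A with its constants tau_1 (for t <= 0) and tau_2 (for t >= 0)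
    displayed.  For 0 < q < 1 the value of [qExp] here is a positive real, so
    its modulus is the value itself. *)
Definition sumudu_class (q : C) (f : C -> C) (tau1 tau2 : R) : Prop :=
  (0 < tau1)%R /\ (0 < tau2)%R /\
  exists M : R, (0 < M)%R /\
    forall t : R,
      ((t <= 0)%R ->
         (Cmod (f t) < M * Cmod (qExp q (RtoC (Rabs t / tau1))))%R) /\
      ((0 <= t)%R ->
         (Cmod (f t) < M * Cmod (qExp q (RtoC (Rabs t / tau2))))%R).

(* Main.v *)
Require Import Defs.
From Stdlib Require Import Reals Lra Lia ZArith.
From Coquelicot Require Import Coquelicot.
Open Scope C_scope.

(** At the nodes [t = w q^n] of the Jackson integral the weight of the transform
    is [(q^(n+1);q)_oo = (q;q)_oo / (q;q)_n], and a power [t^(x-1)] splits as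
    [w^(x-1) (q^(x-1))^n].  The transform of [t^(lambda-1)] is therefore
    [w^(lambda-1) (q;q)_oo] times the sum of [p^n / (q;q)_n] with
    [p = q^lambda], and Euler's identity [euler_identity] evaluates this sum
    as [1 / (p;q)_oo], which is the q-gamma factor.

    For the R function put [p_l = q^(l alpha + beta)].  The same splitting turns
    the transform into [w^(beta-1) (1-q)^(beta-1)] times the double sum, over [l]
    inside and [n] outside, of

      [phi_l * (p_l;q)_oo * p_l^n / (q;q)_n],

    where [phi_l] is the term of the Phi series: the factor [(p_l;q)_oo] comes
    from [1 / Gamma_q(l alpha + beta)].  Summed over [n] first, Euler's identity
    cancels [(p_l;q)_oo] and leaves the Phi series.  So everything rests on the
    exchange of the two sums, [is_series_exchange], for which the double family
    must be dominated by a product [u_l * v_n] of summable families.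

    - In [n]: since [|p_l| < 1] for all [l], [|q^alpha| <= 1], so that
      [|p_l| <= |q^beta| < 1] and the family decays geometrically in [n],
      uniformly in [l].

    - In [l]: one needs the Phi series to converge absolutely, while it is only
      assumed to converge.  In modulus its terms are
      [zeta^l m^(l(l-1)/2)] up to factors bounded above and away from zero
      (no factor of the products [(a_i;q)_l], [(b_j;q)_l], [(q;q)_l] vanishes,
      and the products converge); for such terms, tending to zero already
      implies absolute summability ([ex_series_gaussian_of_lim]).

    On the class A the transform converges because [E_q] is entire, hence
    bounded on the bounded set containing all the nodes. *)

(** * Limits and series of complex numbers *)

(** Stated through the real sequence of distances, so that squeeze arguments for
    real sequences apply directly. *)
Definition tends_to (u : nat -> C) (l : C) : Prop :=
  is_lim_seq (fun n => Cmod (u n - l)) 0%R.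

Notation Cis_series := (@is_series C_AbsRing C_NormedModule).

Lemma is_lim_seq_0_le (u v : nat -> R) :
  (forall n, (0 <= u n <= v n)%R) -> is_lim_seq v 0%R -> is_lim_seq u 0%R.
Proof.
  intros H Hv.
  apply (is_lim_seq_le_le (fun _ => 0%R) u v 0%R); auto using is_lim_seq_const.
Qed.

Lemma is_series_tends_to (u : nat -> C) (l : C) :
  Cis_series u l <-> tends_to (fun n => @sum_n C_AbelianMonoid u n) l.
Proof.
  split; intros H.
  - apply is_lim_seq_spec; intros eps.
    assert (HN := proj1 (filterlim_locally_ball_norm
                          (K := C_AbsRing) (U := C_NormedModule) _ _) H eps).
    destruct HN as [N HN]; exists N; intros n Hn.
    rewrite Rminus_0_r, Rabs_pos_eq by apply Cmod_ge_0.
    exact (HN n Hn).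
  - apply (filterlim_locally_ball_norm (K := C_AbsRing) (U := C_NormedModule)).
    intros eps.
    apply is_lim_seq_spec in H.
    destruct (H eps) as [N HN]; exists N; intros n Hn.
    specialize (HN n Hn).
    rewrite Rminus_0_r, Rabs_pos_eq in HN by apply Cmod_ge_0.
    exact HN.
Qed.

Lemma tends_to_fst (u : nat -> C) (l : C) :
  tends_to u l -> is_lim_seq (fun n => fst (u n)) (fst l).
Proof.
  intros H.
  apply is_lim_seq_spec; intros eps; apply is_lim_seq_spec in H.
  destruct (H eps) as [N HN]; exists N; intros n Hn.
  specialize (HN n Hn).
  rewrite Rminus_0_r, Rabs_pos_eq in HN by apply Cmod_ge_0.
  apply Rle_lt_trans with (2 := HN); exact (re_le_Cmod (u n - l)).
Qed.

Lemma tends_to_snd (u : nat -> C) (l : C) :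
  tends_to u l -> is_lim_seq (fun n => snd (u n)) (snd l).
Proof.
  intros H.
  apply is_lim_seq_spec; intros eps; apply is_lim_seq_spec in H.
  destruct (H eps) as [N HN]; exists N; intros n Hn.
  specialize (HN n Hn).
  rewrite Rminus_0_r, Rabs_pos_eq in HN by apply Cmod_ge_0.
  apply Rle_lt_trans with (2 := HN).
  apply Rle_trans with (2 := Rmax_Cmod (u n - l)); apply Rmax_r.
Qed.

Lemma CLim_unique (u : nat -> C) (l : C) : tends_to u l -> CLim u = l.
Proof.
  intros H; unfold CLim.
  rewrite (is_lim_seq_unique _ _ (tends_to_fst u l H)),
    (is_lim_seq_unique _ _ (tends_to_snd u l H)).
  now destruct l.
Qed.

Lemma tends_to_unique (u : nat -> C) (l m : C) :
  tends_to u l -> tends_to u m -> l = m.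
Proof.
  intros Hl Hm; now rewrite <- (CLim_unique u l Hl), (CLim_unique u m Hm).
Qed.

Lemma tends_to_ext (u v : nat -> C) (l : C) :
  (forall n, u n = v n) -> tends_to u l -> tends_to v l.
Proof.
  intros H; apply is_lim_seq_ext; intros n; now rewrite H.
Qed.

Lemma tends_to_scal (c : C) (u : nat -> C) (l : C) :
  tends_to u l -> tends_to (fun n => c * u n) (c * l).
Proof.
  intros H; unfold tends_to.
  apply is_lim_seq_ext with (fun n => (Cmod c * Cmod (u n - l))%R).
  - intros n; rewrite <- Cmod_mult; f_equal; ring.
  - replace (Finite 0) with (Rbar_mult (Cmod c) 0%R)
      by (simpl; f_equal; ring).
    now apply is_lim_seq_scal_l.
Qed.

Lemma tends_to_shift (u : nat -> C) (l : C) (N : nat) :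
  tends_to u l -> tends_to (fun n => u (n + N)%nat) l.
Proof. apply (is_lim_seq_incr_n (fun n => Cmod (u n - l)) N). Qed.

Lemma tends_to_Cmod (u : nat -> C) (l : C) :
  tends_to u l -> is_lim_seq (fun n => Cmod (u n)) (Cmod l).
Proof.
  intros H.
  apply is_lim_seq_spec; intros eps; apply is_lim_seq_spec in H.
  destruct (H eps) as [N HN]; exists N; intros n Hn.
  specialize (HN n Hn).
  rewrite Rminus_0_r, Rabs_pos_eq in HN by apply Cmod_ge_0.
  apply Rle_lt_trans with (2 := HN).
  assert (H1 := Cmod_triangle (u n - l) l).
  replace (u n - l + l) with (u n) in H1 by ring.
  assert (H2 := Cmod_triangle (- (u n - l)) (u n)).
  rewrite Cmod_opp in H2.
  replace (- (u n - l) + u n) with l in H2 by ring.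
  apply Rabs_le; lra.
Qed.

Lemma tends_to_Cmod_le (u : nat -> C) (l : C) (K : R) :
  tends_to u l -> (forall n, Cmod (u n) <= K)%R -> (Cmod l <= K)%R.
Proof.
  intros H HK.
  exact (is_lim_seq_le _ (fun _ => K) (Cmod l) K HK
           (tends_to_Cmod u l H) (is_lim_seq_const K)).
Qed.

Lemma tends_to_Cmod_ge (u : nat -> C) (l : C) (c : R) :
  tends_to u l -> (forall n, c <= Cmod (u n))%R -> (c <= Cmod l)%R.
Proof.
  intros H Hc.
  exact (is_lim_seq_le (fun _ => c) _ c (Cmod l) Hc
           (is_lim_seq_const c) (tends_to_Cmod u l H)).
Qed.

Lemma CSeries_unique (u : nat -> C) (l : C) : Cis_series u l -> CSeries u = l.
Proof.
  intros H; apply is_series_tends_to in H.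
  assert (Hf : forall n, fst (@sum_n C_AbelianMonoid u n)
                         = sum_n (fun k => fst (u k)) n).
  { induction n as [|n IH]; [now rewrite !sum_O|].
    rewrite !sum_Sn, <- IH; reflexivity. }
  assert (Hs : forall n, snd (@sum_n C_AbelianMonoid u n)
                         = sum_n (fun k => snd (u k)) n).
  { induction n as [|n IH]; [now rewrite !sum_O|].
    rewrite !sum_Sn, <- IH; reflexivity. }
  unfold CSeries.
  rewrite (is_series_unique _ (fst l)), (is_series_unique _ (snd l)).
  - now destruct l.
  - exact (is_lim_seq_ext _ _ _ Hs (tends_to_snd _ _ H)).
  - exact (is_lim_seq_ext _ _ _ Hf (tends_to_fst _ _ H)).
Qed.

Lemma CSeries_correct (u : nat -> C) :
  Cconverges u -> Cis_series u (CSeries u).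
Proof. intros [l Hl]; now rewrite (CSeries_unique u l Hl). Qed.

Lemma CSeries_ext (u v : nat -> C) :
  (forall n, u n = v n) -> CSeries u = CSeries v.
Proof.
  intros H; unfold CSeries; f_equal; apply Series_ext; intros n; now rewrite H.
Qed.

Lemma Cconverges_dominated (u : nat -> C) (v : nat -> R) :
  (forall n, Cmod (u n) <= v n)%R -> ex_series v -> Cconverges u.
Proof. exact (ex_series_le (V := C_CompleteNormedModule) u v). Qed.

Lemma is_series_Cscal (c : C) (u : nat -> C) (l : C) :
  Cis_series u l -> Cis_series (fun n => c * u n) (c * l).
Proof. exact (is_series_scal (V := C_NormedModule) c u l). Qed.

Lemma Cmod_series_le (u : nat -> C) (v : nat -> R) (l : C) :
  Cis_series u l -> (forall n, Cmod (u n) <= v n)%R -> ex_series v ->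
  (Cmod l <= Series v)%R.
Proof.
  intros Hu Hv Hex.
  assert (Hpos : forall n, (0 <= v n)%R)
    by (intros n; apply Rle_trans with (2 := Hv n); apply Cmod_ge_0).
  apply is_series_tends_to, tends_to_Cmod in Hu.
  apply (is_lim_seq_le _ (sum_n v) (Cmod l) (Series v)) with (2 := Hu).
  - induction n as [|n IH]; [now rewrite !sum_O|].
    rewrite !sum_Sn.
    eapply Rle_trans; [apply Cmod_triangle|].
    apply Rplus_le_compat; auto.
  - exact (Series_correct v Hex).
Qed.

Lemma Cmod_series_tail_le (u : nat -> C) (v : nat -> R) (l : C) (N : nat) :
  Cis_series u l -> (forall n, Cmod (u n) <= v n)%R -> ex_series v ->
  (Cmod (l - @sum_n C_AbelianMonoid u N) <= Series v - sum_n v N)%R.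
Proof.
  intros Hu Hv Hex.
  assert (Htail : Cis_series (fun k => u (S N + k)%nat)
                    (l - @sum_n C_AbelianMonoid u N)).
  { apply (is_series_incr_n (V := C_NormedModule)); [lia|].
    replace (plus _ _) with l; [exact Hu|].
    change (l = l - @sum_n C_AbelianMonoid u N + @sum_n C_AbelianMonoid u N).
    ring. }
  rewrite (Series_incr_n v (S N)); [|lia|exact Hex].
  rewrite <- sum_n_Reals; simpl pred.
  replace (_ + _ - _)%R with (Series (fun k => v (S N + k)%nat)) by ring.
  apply (Cmod_series_le _ _ _ Htail).
  - intros n; apply Hv.
  - now apply (ex_series_incr_n v (S N)).
Qed.

(** Fubini for series, in the form needed here: truncating the sum over [n] at
    [N] commutes with the sum over [l], and the product bound makes the total
    error at most [Series u] times the [N]-th tail of [v]. *)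
Lemma is_series_exchange (a : nat -> nat -> C) (u v : nat -> R)
    (A B : nat -> C) :
  ex_series u -> ex_series v ->
  (forall n l, Cmod (a n l) <= u l * v n)%R ->
  (forall l, Cis_series (fun n => a n l) (A l)) ->
  (forall n, Cis_series (a n) (B n)) ->
  Cis_series B (CSeries A).
Proof.
  intros Hu Hv Hdom HA HB.
  assert (HvC : forall l, ex_series (fun n => u l * v n)%R)
    by (intros l; exact (ex_series_scal (V := R_NormedModule) (u l) v Hv)).
  assert (HT : Cis_series A (CSeries A)).
  { apply CSeries_correct.
    apply Cconverges_dominated with (fun l => u l * Series v)%R.
    - intros l; rewrite <- Series_scal_l.
      apply (Cmod_series_le _ _ _ (HA l)); auto.
    - now apply ex_series_scal_r. }
  assert (HS : forall N, Cis_series (fun l => @sum_n C_AbelianMonoid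
                 (fun n => a n l) N) (@sum_n C_AbelianMonoid B N)).
  { induction N as [|N IH].
    - rewrite sum_O; apply is_series_ext with (2 := HB O).
      intros l; now rewrite sum_O.
    - rewrite sum_Sn.
      apply is_series_ext with (2 := is_series_plus _ _ _ _ IH (HB (S N))).
      intros l; now rewrite sum_Sn. }
  apply is_series_tends_to.
  apply is_lim_seq_0_le with
    (fun N => Series u * (Series v - sum_n v N))%R.
  - intros N; split; [apply Cmod_ge_0|].
    rewrite <- Cmod_opp.
    replace (- (@sum_n C_AbelianMonoid B N - CSeries A))
      with (CSeries A - @sum_n C_AbelianMonoid B N) by ring.
    rewrite <- Series_scal_r.
    apply Cmod_series_le with
      (fun l => A l - @sum_n C_AbelianMonoid (fun n => a n l) N).
    + exact (is_series_minus _ _ _ _ HT (HS N)).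
    + intros l.
      eapply Rle_trans;
        [apply (Cmod_series_tail_le _ _ _ N (HA l) (fun n => Hdom n l) (HvC l))|].
      rewrite Series_scal_l.
      replace (sum_n (fun n => u l * v n)%R N) with (u l * sum_n v N)%R
        by exact (eq_sym (sum_n_mult_l (K := R_Ring) (u l) v N)).
      apply Req_le; ring.
    + now apply ex_series_scal_r.
  - replace (Finite 0) with (Rbar_mult (Series u) (Series v - Series v)%R)
      by (simpl; f_equal; ring).
    apply is_lim_seq_scal_l.
    apply is_lim_seq_minus'; [apply is_lim_seq_const|].
    exact (Series_correct v Hv).
Qed.

(** * Finite and infinite q-products *)

Lemma exp_monotone (x y : R) : (x <= y)%R -> (exp x <= exp y)%R.
Proof.
  intros [H|H]; [now apply Rlt_le, exp_increasing|rewrite H; apply Rle_refl].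
Qed.

Lemma ex_series_geom_Cmod (q : C) :
  (Cmod q < 1)%R -> ex_series (fun n => Cmod q ^ n)%R.
Proof.
  intros Hq; apply ex_series_geom; now rewrite Rabs_pos_eq by apply Cmod_ge_0.
Qed.

Lemma Cmod_pow_le_1 (q : C) (n : nat) :
  (Cmod q <= 1)%R -> (Cmod (q ^ n) <= 1)%R.
Proof.
  intros Hq; rewrite Cmod_pow, <- (pow1 n).
  apply pow_incr; split; [apply Cmod_ge_0|exact Hq].
Qed.

Lemma Cmod_lt_1_neq (p : C) : (Cmod p < 1)%R -> p <> 1.
Proof. intros H E; rewrite E, Cmod_1 in H; lra. Qed.

Lemma Cmod_lt_1_pow (q p : C) (n : nat) :
  (Cmod q < 1)%R -> (Cmod p < 1)%R -> (Cmod (p * q ^ n) < 1)%R.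
Proof.
  intros Hq Hp; rewrite Cmod_mult.
  assert (H1 := Cmod_pow_le_1 q n (Rlt_le _ _ Hq)).
  assert (H2 := Cmod_ge_0 p); assert (H3 := Cmod_ge_0 (q ^ n)); nra.
Qed.

Lemma qpoch_S (a q : C) (n : nat) :
  qpoch a q (S n) = qpoch a q n * (1 - a * q ^ n).
Proof. reflexivity. Qed.

Lemma qpoch_S_l (a q : C) (n : nat) :
  qpoch a q (S n) = (1 - a) * qpoch (a * q) q n.
Proof.
  induction n as [|n IH]; [unfold qpoch; simpl; ring|].
  rewrite qpoch_S, IH, qpoch_S, Cpow_S; ring.
Qed.

Lemma qpoch_add (a q : C) (N n : nat) :
  qpoch a q (n + N) = qpoch a q N * qpoch (a * q ^ N) q n.
Proof.
  induction n as [|n IH]; [unfold qpoch; simpl; ring|].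
  simpl Nat.add; rewrite !qpoch_S, IH, Cpow_add_r; ring.
Qed.

(** Peeling off the first factor keeps the bound in closed form:
    [|1 - a| <= exp |a|] and [|a| + |a q| / (1 - |q|) = |a| / (1 - |q|)]. *)
Lemma Cmod_qpoch_le (a q : C) (n : nat) :
  (Cmod q < 1)%R -> (Cmod (qpoch a q n) <= exp (Cmod a / (1 - Cmod q)))%R.
Proof.
  intros Hq; revert a; induction n as [|n IH]; intros a.
  - unfold qpoch; simpl; rewrite Cmod_1.
    rewrite <- exp_0 at 1; apply exp_monotone.
    apply Rcomplements.Rdiv_le_0_compat; [apply Cmod_ge_0|lra].
  - rewrite qpoch_S_l, Cmod_mult.
    replace (Cmod a / (1 - Cmod q))%R
      with (Cmod a + Cmod (a * q) / (1 - Cmod q))%R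
      by (rewrite Cmod_mult; field; lra).
    rewrite exp_plus.
    apply Rmult_le_compat; try apply Cmod_ge_0; [|apply IH].
    apply Rle_trans with (1 + Cmod a)%R; [|apply exp_ineq1_le].
    assert (H := Cmod_triangle 1 (- a)); rewrite Cmod_1, Cmod_opp in H; exact H.
Qed.

(** The inequality [prod (1 - x_i) >= 1 - sum x_i] for a geometric [x_i]; it is
    informative when [|a|] is small. *)
Lemma Cmod_qpoch_ge (a q : C) (n : nat) :
  (Cmod q < 1)%R -> (Cmod a <= 1)%R ->
  (1 - Cmod a / (1 - Cmod q) <= Cmod (qpoch a q n))%R.
Proof.
  intros Hq; revert a; induction n as [|n IH]; intros a Ha.
  - unfold qpoch; simpl; rewrite Cmod_1.
    assert (0 <= Cmod a / (1 - Cmod q))%R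
      by (apply Rcomplements.Rdiv_le_0_compat; [apply Cmod_ge_0|lra]).
    lra.
  - assert (Hq0 := Cmod_ge_0 q); assert (Ha0 := Cmod_ge_0 a).
    assert (Haq : (Cmod (a * q) <= 1)%R) by (rewrite Cmod_mult; nra).
    specialize (IH _ Haq).
    rewrite qpoch_S_l, Cmod_mult.
    replace (Cmod a / (1 - Cmod q))%R
      with (Cmod a + Cmod (a * q) / (1 - Cmod q))%R
      by (rewrite Cmod_mult; field; lra).
    assert (Hx : (0 <= Cmod (a * q) / (1 - Cmod q))%R)
      by (apply Rcomplements.Rdiv_le_0_compat; [apply Cmod_ge_0|lra]).
    revert IH Hx; generalize (Cmod (a * q) / (1 - Cmod q))%R; intros x IH Hx.
    assert (H := Cmod_triangle (1 - a) a).
    replace (1 - a + a) with (RtoC 1) in H by ring; rewrite Cmod_1 in H.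
    assert (HQ := Cmod_ge_0 (qpoch (a * q) q n)).
    apply Rle_trans with ((1 - Cmod a) * Cmod (qpoch (a * q) q n))%R; nra.
Qed.

(** For small [|a|] this is [Cmod_qpoch_ge]; since
    [(a;q)_(n+1) = (1 - a) (aq;q)_n], finitely many nonzero factors reduce the
    general case to that one. *)
Lemma qpoch_bounded_below (a q : C) :
  (Cmod q < 1)%R -> (forall l, a * q ^ l <> 1) ->
  exists c : R, (0 < c)%R /\ forall n, (c <= Cmod (qpoch a q n))%R.
Proof.
  intros Hq Ha.
  assert (HN : exists N, (Cmod a * Cmod q ^ N <= (1 - Cmod q) / 2)%R).
  { assert (Hl : is_lim_seq (fun n => Cmod a * Cmod q ^ n)%R 0%R).
    { replace (Finite 0) with (Rbar_mult (Cmod a) 0%R)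
        by (simpl; f_equal; ring).
      apply is_lim_seq_scal_l, is_lim_seq_geom.
      now rewrite Rabs_pos_eq by apply Cmod_ge_0. }
    apply is_lim_seq_spec in Hl.
    assert (He : (0 < (1 - Cmod q) / 2)%R) by lra.
    destruct (Hl (mkposreal _ He)) as [N HN]; exists N.
    specialize (HN N (Nat.le_refl N)); simpl in HN.
    rewrite Rminus_0_r in HN.
    apply Rlt_le, Rle_lt_trans with (2 := HN), Rle_abs. }
  destruct HN as [N HN]; revert a Ha HN.
  induction N as [|N IH]; intros a Ha HN.
  - rewrite pow_O, Rmult_1_r in HN.
    exists (1 / 2)%R; split; [lra|]; intros n.
    assert (Hq0 := Cmod_ge_0 q); assert (Ha0 := Cmod_ge_0 a).
    eapply Rle_trans; [|apply Cmod_qpoch_ge; lra].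
    assert (Cmod a / (1 - Cmod q) <= 1 / 2)%R; [|lra].
    apply Rmult_le_reg_r with (1 - Cmod q)%R; [lra|].
    unfold Rdiv; rewrite Rmult_assoc, Rinv_l by lra; lra.
  - destruct (IH (a * q)) as [c [Hc Hn]].
    + intros l; specialize (Ha (S l)); rewrite Cpow_S in Ha.
      now rewrite <- Cmult_assoc.
    + rewrite Cmod_mult; simpl in HN; lra.
    + assert (Ha1 : (0 < Cmod (1 - a))%R).
      { apply Cmod_gt_0; intros E; apply (Ha O); simpl.
        replace a with (1 - (1 - a)) by ring; rewrite E; ring. }
      exists (Rmin 1 (Cmod (1 - a) * c))%R; split.
      * apply Rmin_glb_lt; [lra|now apply Rmult_lt_0_compat].
      * intros [|n].
        { unfold qpoch; simpl; rewrite Cmod_1; apply Rmin_l. }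
        rewrite qpoch_S_l, Cmod_mult.
        eapply Rle_trans; [apply Rmin_r|].
        apply Rmult_le_compat_l; [apply Cmod_ge_0|apply Hn].
Qed.

(** The successive differences are [- a q^n (a;q)_n], which are dominated by a
    geometric sequence. *)
Lemma qpoch_tends_to (a q : C) :
  (Cmod q < 1)%R -> tends_to (qpoch a q) (qpoch_inf a q).
Proof.
  intros Hq.
  assert (Hd : Cconverges (fun n => qpoch a q (S n) - qpoch a q n)).
  { apply Cconverges_dominated with
      (fun n => Cmod a * exp (Cmod a / (1 - Cmod q)) * Cmod q ^ n)%R.
    - intros n; rewrite qpoch_S.
      replace (qpoch a q n * (1 - a * q ^ n) - qpoch a q n)
        with (- (a * qpoch a q n * q ^ n)) by ring.
      rewrite Cmod_opp, !Cmod_mult, Cmod_pow.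
      apply Rmult_le_compat_r; [apply pow_le, Cmod_ge_0|].
      apply Rmult_le_compat_l; [apply Cmod_ge_0|now apply Cmod_qpoch_le].
    - exact (ex_series_scal (V := R_NormedModule) _ _
               (ex_series_geom_Cmod q Hq)). }
  destruct Hd as [D HD]; apply is_series_tends_to in HD.
  assert (Hs : forall n, @sum_n C_AbelianMonoid
             (fun n => qpoch a q (S n) - qpoch a q n) n = qpoch a q (S n) - 1).
  { induction n as [|n IH].
    - rewrite sum_O; unfold qpoch; simpl; ring.
    - rewrite sum_Sn, IH.
      change (qpoch a q (S n) - 1 + (qpoch a q (S (S n)) - qpoch a q (S n))
              = qpoch a q (S (S n)) - 1); ring. }
  assert (HL : tends_to (qpoch a q) (D + 1)).
  { apply (is_lim_seq_incr_1 (fun n => Cmod (qpoch a q n - (D + 1)))).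
    revert HD; apply is_lim_seq_ext; intros n; rewrite Hs; f_equal; ring. }
  unfold qpoch_inf; now rewrite (CLim_unique _ _ HL).
Qed.

Lemma qpoch_inf_split (a q : C) (N : nat) :
  (Cmod q < 1)%R ->
  qpoch_inf a q = qpoch a q N * qpoch_inf (a * q ^ N) q.
Proof.
  intros Hq.
  apply tends_to_unique with (fun n => qpoch a q (n + N)).
  - now apply tends_to_shift, qpoch_tends_to.
  - apply tends_to_ext with (fun n => qpoch a q N * qpoch (a * q ^ N) q n).
    + intros n; now rewrite qpoch_add.
    + now apply tends_to_scal, qpoch_tends_to.
Qed.

Lemma Cmod_qpoch_inf_le (a q : C) :
  (Cmod q < 1)%R -> (Cmod a <= 1)%R ->
  (Cmod (qpoch_inf a q) <= exp (1 / (1 - Cmod q)))%R.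
Proof.
  intros Hq Ha.
  apply tends_to_Cmod_le with (qpoch a q); [now apply qpoch_tends_to|].
  intros n; eapply Rle_trans; [now apply Cmod_qpoch_le|].
  apply exp_monotone; apply Rmult_le_compat_r; [|exact Ha].
  apply Rlt_le, Rinv_0_lt_compat; lra.
Qed.

Lemma qpoch_inf_neq_0 (a q : C) :
  (Cmod q < 1)%R -> (forall l, a * q ^ l <> 1) -> qpoch_inf a q <> 0.
Proof.
  intros Hq Ha.
  destruct (qpoch_bounded_below a q Hq Ha) as [c [Hc Hn]].
  apply Cmod_gt_0, Rlt_le_trans with (1 := Hc).
  now apply tends_to_Cmod_ge with (qpoch a q); [apply qpoch_tends_to|].
Qed.

Lemma qpoch_inf_neq_0_disc (p q : C) :
  (Cmod q < 1)%R -> (Cmod p < 1)%R -> qpoch_inf p q <> 0.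
Proof.
  intros Hq Hp; apply qpoch_inf_neq_0; [exact Hq|].
  intros l; now apply Cmod_lt_1_neq, Cmod_lt_1_pow.
Qed.

Lemma qpoch_neq_0_disc (p q : C) (n : nat) :
  (Cmod q < 1)%R -> (Cmod p < 1)%R -> qpoch p q n <> 0.
Proof.
  intros Hq Hp E; apply (qpoch_inf_neq_0_disc p q Hq Hp).
  rewrite (qpoch_inf_split p q n Hq), E; ring.
Qed.

Lemma inv_qqn_bounded (q : C) :
  (Cmod q < 1)%R ->
  exists K : R, (0 < K)%R /\ forall n, (Cmod (/ qpoch q q n) <= K)%R.
Proof.
  intros Hq.
  destruct (qpoch_bounded_below q q Hq) as [c [Hc Hn]].
  { intros l; now apply Cmod_lt_1_neq, Cmod_lt_1_pow. }
  exists (/ c)%R; split; [now apply Rinv_0_lt_compat|]; intros n.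
  rewrite Cmod_inv by now apply qpoch_neq_0_disc.
  now apply Rinv_le_contravar.
Qed.

(** * Euler's identity *)

Lemma euler_converges (q p : C) :
  (Cmod q < 1)%R -> (Cmod p < 1)%R -> Cconverges (fun n => p ^ n / qpoch q q n).
Proof.
  intros Hq Hp.
  destruct (inv_qqn_bounded q Hq) as [K [HK Hn]].
  apply Cconverges_dominated with (fun n => K * Cmod p ^ n)%R.
  - intros n; unfold Cdiv; rewrite Cmod_mult, Cmod_pow, Rmult_comm.
    apply Rmult_le_compat_r; [apply pow_le, Cmod_ge_0|apply Hn].
  - exact (ex_series_scal (V := R_NormedModule) _ _
             (ex_series_geom_Cmod p Hp)).
Qed.

(** Because [(1 - q^n) / (q;q)_n = 1 / (q;q)_(n-1)]. *)
Lemma euler_functional (q p : C) :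
  (Cmod q < 1)%R -> (Cmod p < 1)%R ->
  (1 - p) * CSeries (fun n => p ^ n / qpoch q q n)
  = CSeries (fun n => (p * q) ^ n / qpoch q q n).
Proof.
  intros Hq Hp.
  set (F := CSeries (fun n => p ^ n / qpoch q q n)).
  assert (HF := CSeries_correct _ (euler_converges q p Hq Hp)); fold F in HF.
  assert (Hpq : (Cmod (p * q) < 1)%R).
  { rewrite <- (Cpow_1_r q) at 1; now apply Cmod_lt_1_pow. }
  set (G := CSeries (fun n => (p * q) ^ n / qpoch q q n)).
  assert (HG := CSeries_correct _ (euler_converges q _ Hq Hpq)); fold G in HG.
  assert (H1 : Cis_series (fun n => p * (p ^ n / qpoch q q n)) (F - G)).
  { assert (HFG := is_series_minus _ _ _ _ HF HG).
    apply is_series_ext with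
      (fun n => p ^ S n / qpoch q q (S n) - (p * q) ^ S n / qpoch q q (S n)).
    - intros n.
      change (p ^ S n / qpoch q q (S n) - (p * q) ^ S n / qpoch q q (S n)
              = p * (p ^ n / qpoch q q n)).
      assert (Hn := qpoch_neq_0_disc q q (S n) Hq Hq).
      assert (Hn' := qpoch_neq_0_disc q q n Hq Hq).
      rewrite Cpow_mult_l, !Cpow_S.
      rewrite qpoch_S in *.
      assert (1 - q * q ^ n <> 0).
      { intros E; apply Hn; rewrite E; ring. }
      field; auto.
    - apply (is_series_incr_1 (V := C_NormedModule)
               (fun n => p ^ n / qpoch q q n - (p * q) ^ n / qpoch q q n)).
      replace (plus _ _) with (F - G); [exact HFG|].
      change (F - G = F - G + (p ^ 0 / qpoch q q 0 - (p * q) ^ 0 / qpoch q q 0)).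
      simpl; ring. }
  assert (H2 := CSeries_unique _ _ H1).
  rewrite (CSeries_unique _ _ (is_series_Cscal p _ _ HF)) in H2.
  replace ((1 - p) * F) with (F - p * F) by ring; rewrite H2; ring.
Qed.

(** Iterating the functional equation gives [F(p) (p;q)_N = F(p q^N)], and the
    right-hand side tends to [F(0) = 1]. *)
Lemma euler_identity (q p : C) :
  (Cmod q < 1)%R -> (Cmod p < 1)%R ->
  Cis_series (fun n => p ^ n / qpoch q q n) (/ qpoch_inf p q).
Proof.
  intros Hq Hp.
  set (F := fun x => CSeries (fun n => x ^ n / qpoch q q n)).
  assert (Hiter : forall N, F p * qpoch p q N = F (p * q ^ N)).
  { induction N as [|N IH].
    - unfold qpoch; simpl; rewrite !Cmult_1_r; reflexivity.
    - rewrite qpoch_S, Cmult_assoc, IH, Cmult_comm.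
      unfold F; rewrite euler_functional; [|exact Hq|now apply Cmod_lt_1_pow].
      apply CSeries_ext; intros n; rewrite Cpow_S; f_equal; f_equal; ring. }
  (* F is continuous at 0 with F 0 = 1 *)
  destruct (inv_qqn_bounded q Hq) as [K [HK Hn]].
  assert (H0 : forall N, (Cmod (F (p * q ^ N)%C - 1)
                <= Cmod q ^ N * (Cmod p * K * Series (fun n => Cmod p ^ n)))%R).
  { intros N; set (x := p * q ^ N).
    assert (Hx : (Cmod x < 1)%R) by now apply Cmod_lt_1_pow.
    assert (HxN : Cmod x = (Cmod p * Cmod q ^ N)%R)
      by (unfold x; now rewrite Cmod_mult, Cmod_pow).
    assert (Hxp : (Cmod x <= Cmod p)%R).
    { rewrite HxN, <- Cmod_pow.
      apply Rle_trans with (Cmod p * 1)%R; [|lra].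
      apply Rmult_le_compat_l; [apply Cmod_ge_0|].
      now apply Cmod_pow_le_1, Rlt_le. }
    assert (HF := CSeries_correct _ (euler_converges q x Hq Hx)).
    fold (F x) in HF.
    assert (HF1 : Cis_series (fun n => x ^ S n / qpoch q q (S n)) (F x - 1)).
    { apply (is_series_incr_1 (V := C_NormedModule)
               (fun n => x ^ n / qpoch q q n)).
      replace (plus _ _) with (F x); [exact HF|].
      change (F x = F x - 1 + x ^ 0 / qpoch q q 0).
      unfold qpoch; simpl; field. }
    replace (Cmod q ^ N * (Cmod p * K * Series (fun n => Cmod p ^ n)))%R
      with (Series (fun n => (Cmod x * K) * Cmod p ^ n))%R
      by (rewrite (Series_scal_l _ (fun n => Cmod p ^ n)%R), HxN; ring).
    apply (Cmod_series_le _ _ _ HF1).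
    - intros n; unfold Cdiv; rewrite Cmod_mult, Cmod_pow.
      simpl pow.
      replace (Cmod x * K * Cmod p ^ n)%R with (Cmod x * Cmod p ^ n * K)%R
        by ring.
      apply Rmult_le_compat; [|apply Cmod_ge_0| |apply Hn].
      + apply Rmult_le_pos; [|apply pow_le]; apply Cmod_ge_0.
      + apply Rmult_le_compat_l; [apply Cmod_ge_0|].
        apply pow_incr; split; [apply Cmod_ge_0|exact Hxp].
    - exact (ex_series_scal (V := R_NormedModule) _ _
               (ex_series_geom_Cmod p Hp)). }
  assert (HL1 : tends_to (fun N => F (p * q ^ N)) 1).
  { apply is_lim_seq_0_le with (1 := fun N => conj (Cmod_ge_0 _) (H0 N)).
    set (M := (Cmod p * K * Series (fun n => Cmod p ^ n))%R).
    replace (Finite 0) with (Rbar_mult 0%R M) by (simpl; f_equal; ring).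
    apply is_lim_seq_scal_r, is_lim_seq_geom.
    now rewrite Rabs_pos_eq by apply Cmod_ge_0. }
  assert (HFp : F p * qpoch_inf p q = 1).
  { apply tends_to_unique with (fun N => F (p * q ^ N)); [|exact HL1].
    apply tends_to_ext with (1 := Hiter).
    now apply tends_to_scal, qpoch_tends_to. }
  assert (Hnz := qpoch_inf_neq_0_disc p q Hq Hp).
  replace (/ qpoch_inf p q) with (F p).
  - exact (CSeries_correct _ (euler_converges q p Hq Hp)).
  - rewrite <- (Cmult_1_r (F p)), <- (Cinv_r _ Hnz), Cmult_assoc, HFp; ring.
Qed.

(** * Complex powers *)

Lemma Cexp_plus (x y : C) : Cexp (x + y) = Cexp x * Cexp y.
Proof.
  unfold Cexp; simpl fst; simpl snd.
  rewrite exp_plus, cos_plus, sin_plus.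
  apply injective_projections; simpl; ring.
Qed.

Lemma Cexp_0 : Cexp 0 = 1.
Proof.
  unfold Cexp; simpl; rewrite exp_0, cos_0, sin_0.
  apply injective_projections; simpl; ring.
Qed.

Lemma Cexp_neq_0 (x : C) : Cexp x <> 0.
Proof.
  intros H; apply C1_nz.
  rewrite <- Cexp_0; replace (RtoC 0) with (x + - x) by ring.
  rewrite Cexp_plus, H; ring.
Qed.

Lemma Cexp_opp (x : C) : Cexp (- x) = / Cexp x.
Proof.
  assert (H := Cexp_neq_0 x).
  rewrite <- (Cmult_1_l (/ Cexp x)), <- Cexp_0.
  replace (RtoC 0) with (- x + x) by ring.
  rewrite Cexp_plus, <- Cmult_assoc, (Cinv_r _ H); ring.
Qed.

Lemma Cexp_INR (n : nat) (x : C) : Cexp (INR n * x) = Cexp x ^ n.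
Proof.
  induction n as [|n IH].
  - simpl; rewrite Cmult_0_l; apply Cexp_0.
  - rewrite S_INR, RtoC_plus, Cpow_S, <- IH, <- Cexp_plus; f_equal; ring.
Qed.

Lemma cpow_neq_0 (Lg : C -> C) (u x : C) : cpow Lg u x <> 0.
Proof. apply Cexp_neq_0. Qed.

Lemma cpow_plus (Lg : C -> C) (u x y : C) :
  cpow Lg u (x + y) = cpow Lg u x * cpow Lg u y.
Proof. unfold cpow; rewrite <- Cexp_plus; f_equal; ring. Qed.

Lemma cpow_opp (Lg : C -> C) (u x : C) : cpow Lg u (- x) = / cpow Lg u x.
Proof. unfold cpow; rewrite <- Cexp_opp; f_equal; ring. Qed.

Lemma cpow_INR (Lg : C -> C) (u x : C) (n : nat) :
  cpow Lg u (INR n * x) = cpow Lg u x ^ n.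
Proof. unfold cpow; rewrite <- Cexp_INR; f_equal; ring. Qed.

Lemma cpow_1 (Lg : C -> C) (u : C) :
  log_branch Lg -> u <> 0 -> cpow Lg u 1 = u.
Proof. intros H Hu; unfold cpow; rewrite Cmult_1_l; now apply H. Qed.

Lemma cpow_lattice (Lg : C -> C) (q w x : C) (n : nat) :
  branch_on_lattice Lg q w ->
  cpow Lg (w * q ^ n) x = cpow Lg w x * cpow Lg q x ^ n.
Proof.
  intros H; unfold cpow; rewrite (H n), <- Cexp_INR, <- Cexp_plus.
  f_equal; ring.
Qed.

Lemma one_minus_neq_0 (q : C) : (Cmod q < 1)%R -> 1 - q <> 0.
Proof.
  intros Hq E; apply (Cmod_lt_1_neq q Hq).
  replace q with (1 - (1 - q)) by ring; rewrite E; ring.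
Qed.

(** * The transform as a series, and the transform of powers *)

Lemma sumudu_term_eq (q : C) (f : C -> C) (w : C) (n : nat) :
  w <> 0 ->
  jackson_term q (sumudu_integrand q f w) w n
  = q ^ n * (f (w * q ^ n) * qpoch_inf (q * q ^ n) q).
Proof.
  intros Hw; unfold jackson_term, sumudu_integrand.
  replace (q * (w * q ^ n) / w) with (q * q ^ n) by (field; exact Hw).
  reflexivity.
Qed.

Lemma sumudu_series (q : C) (f : C -> C) (w : C) :
  (Cmod q < 1)%R -> w <> 0 ->
  sumudu q f w = CSeries (jackson_term q (sumudu_integrand q f w) w).
Proof.
  intros Hq Hw; unfold sumudu, jackson.
  assert (H1 := one_minus_neq_0 q Hq); field; auto.
Qed.

(** The prefactor of the Jackson integral cancels that of the transform, so the
    transform is just the series of weighted values at the nodes. *)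
Lemma sumudu_is_series (q : C) (f : C -> C) (w L : C) :
  (Cmod q < 1)%R -> w <> 0 ->
  Cis_series (fun n => q ^ n * (f (w * q ^ n) * qpoch_inf (q * q ^ n) q)) L ->
  sumudu_converges q f w /\ sumudu q f w = L.
Proof.
  intros Hq Hw HL.
  assert (H : Cis_series (jackson_term q (sumudu_integrand q f w) w) L).
  { apply is_series_ext with (2 := HL); intros n.
    now rewrite sumudu_term_eq. }
  split; [now exists L|].
  rewrite sumudu_series by assumption; now apply CSeries_unique.
Qed.

Lemma sumudu_unit_interval (q : C) (f : C -> C) (w : C) :
  (Cmod q < 1)%R -> w <> 0 ->
  sumudu q f w
  = / (1 - q) * jackson q (fun t => f (w * t) * qpoch_inf (q * t) q) 1.
Proof.
  intros Hq Hw; rewrite sumudu_series by assumption; unfold jackson.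
  rewrite (CSeries_ext _ (jackson_term q (fun t => f (w * t)
             * qpoch_inf (q * t) q) 1)).
  - assert (H1 := one_minus_neq_0 q Hq); field; exact H1.
  - intros n; rewrite sumudu_term_eq by exact Hw.
    unfold jackson_term; now rewrite Cmult_1_l.
Qed.

Lemma qpoch_inf_shift (q : C) (n : nat) :
  (Cmod q < 1)%R ->
  qpoch_inf (q * q ^ n) q = qpoch_inf q q / qpoch q q n.
Proof.
  intros Hq; assert (H := qpoch_neq_0_disc q q n Hq Hq).
  rewrite (qpoch_inf_split q q n Hq); field; exact H.
Qed.

(** Also valid at the poles, where both sides are [0]. *)
Lemma inv_qGamma (Lg : C -> C) (q x : C) :
  (Cmod q < 1)%R ->
  / qGamma Lg q x
  = qpoch_inf (cpow Lg q x) q / qpoch_inf q q * cpow Lg (1 - q) (x - 1).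
Proof.
  intros Hq.
  assert (H1 := cpow_neq_0 Lg (1 - q) (x - 1)).
  assert (H2 := qpoch_inf_neq_0_disc q q Hq Hq).
  destruct (Ceq_dec (qpoch_inf (cpow Lg q x) q) 0) as [E|E].
  - rewrite (inv_qGamma_pole _ _ _ E), E; unfold Cdiv; ring.
  - unfold qGamma; replace (1 - x) with (- (x - 1)) by ring.
    rewrite cpow_opp; field; auto.
Qed.

Lemma sumudu_power (Lg : C -> C) (q w lambda : C) :
  (0 < Cmod q)%R -> (Cmod q < 1)%R -> log_branch Lg -> w <> 0 ->
  branch_on_lattice Lg q w -> (Cmod (cpow Lg q lambda) < 1)%R ->
  sumudu_converges q (fun t => cpow Lg t (lambda - 1)) w /\
  sumudu q (fun t => cpow Lg t (lambda - 1)) w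
  = cpow Lg w (lambda - 1) * cpow Lg (1 - q) (lambda - 1) * qGamma Lg q lambda.
Proof.
  intros Hq0 Hq HLg Hw Hlat Hp; set (p := cpow Lg q lambda) in *.
  apply sumudu_is_series; try assumption.
  assert (Hp' : cpow Lg q (lambda - 1) * q = p).
  { unfold p; rewrite <- (cpow_1 Lg q HLg) at 2 by now apply Cmod_gt_0.
    rewrite <- cpow_plus; f_equal; ring. }
  replace (cpow Lg w (lambda - 1) * cpow Lg (1 - q) (lambda - 1)
           * qGamma Lg q lambda)
    with (cpow Lg w (lambda - 1) * qpoch_inf q q * / qpoch_inf p q).
  - apply is_series_ext with
      (2 := is_series_Cscal _ _ _ (euler_identity q p Hq Hp)).
    intros n; rewrite cpow_lattice, qpoch_inf_shift by assumption.
    rewrite <- Hp', Cpow_mult_l.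
    assert (H := qpoch_neq_0_disc q q n Hq Hq).
    match goal with |- ?x = ?y => change (@eq C x y) end; field; exact H.
  - unfold qGamma; fold p.
    assert (H1 := cpow_neq_0 Lg (1 - q) (lambda - 1)).
    assert (H2 := qpoch_inf_neq_0_disc p q Hq Hp).
    replace (1 - lambda) with (- (lambda - 1)) by ring.
    rewrite cpow_opp; field; auto.
Qed.

(** * Series of Gaussian type *)

Lemma ex_series_ratio (y : nat -> R) (k : R) (L : nat) :
  (forall l, 0 <= y l)%R -> (0 <= k < 1)%R ->
  (forall l, (L <= l)%nat -> (y (S l) <= k * y l)%R) -> ex_series y.
Proof.
  intros Hy Hk HL.
  apply (ex_series_incr_n y L).
  apply (ex_series_le (V := R_CompleteNormedModule) _
           (fun n => y L * k ^ n)%R).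
  - intros n; change (Rabs (y (L + n)%nat) <= y L * k ^ n)%R.
    rewrite Rabs_pos_eq by apply Hy.
    induction n as [|n IH]; [rewrite Nat.add_0_r; simpl; lra|].
    rewrite Nat.add_succ_r; eapply Rle_trans; [apply HL; lia|].
    simpl; apply Rle_trans with (k * (y L * k ^ n))%R; [|lra].
    apply Rmult_le_compat_l; [lra|exact IH].
  - apply (ex_series_scal (V := R_NormedModule)), ex_series_geom.
    rewrite Rabs_pos_eq; lra.
Qed.

Lemma pow_le_decr (m : R) (L l : nat) :
  (0 <= m <= 1)%R -> (L <= l)%nat -> (m ^ l <= m ^ L)%R.
Proof.
  intros Hm Hl; replace l with (L + (l - L))%nat by lia.
  rewrite pow_add.
  apply Rle_trans with (m ^ L * 1)%R; [|lra].
  apply Rmult_le_compat_l; [now apply pow_le|].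
  rewrite <- (pow1 (l - L)); now apply pow_incr.
Qed.

Lemma binom2_S (l : nat) :
  (S l * (S l - 1) / 2 = l * (l - 1) / 2 + l)%nat.
Proof.
  replace (S l * (S l - 1))%nat with (l * (l - 1) + l * 2)%nat
    by (destruct l; simpl; lia).
  now rewrite Nat.div_add by lia.
Qed.

(** The model for the growth of the terms of [Phi] and [qExp]: for
    [Phi], [m = |q|^(1+s-r)], which is below, at or above [1] as [r < s + 1],
    [r = s + 1] or [r > s + 1]. *)
Definition gaussian_term (zeta m : R) (l : nat) : R :=
  (zeta ^ l * m ^ (l * (l - 1) / 2))%R.

Lemma gaussian_term_S (zeta m : R) (l : nat) :
  (gaussian_term zeta m (S l) = zeta * m ^ l * gaussian_term zeta m l)%R.
Proof. unfold gaussian_term; rewrite binom2_S, pow_add; simpl; ring. Qed.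

Lemma gaussian_term_nonneg (zeta m : R) (l : nat) :
  (0 <= zeta)%R -> (0 <= m)%R -> (0 <= gaussian_term zeta m l)%R.
Proof. intros Hz Hm; apply Rmult_le_pos; now apply pow_le. Qed.

Lemma gaussian_term_pos (zeta m : R) (l : nat) :
  (0 < zeta)%R -> (0 < m)%R -> (0 < gaussian_term zeta m l)%R.
Proof. intros Hz Hm; apply Rmult_lt_0_compat; now apply pow_lt. Qed.

Lemma ex_series_gaussian_of_ratio (zeta m : R) (L : nat) :
  (0 <= zeta)%R -> (0 <= m <= 1)%R -> (zeta * m ^ L < 1)%R ->
  ex_series (gaussian_term zeta m).
Proof.
  intros Hz Hm HL.
  apply ex_series_ratio with (zeta * m ^ L)%R L.
  - intros l; now apply gaussian_term_nonneg.
  - split; [|exact HL]; apply Rmult_le_pos; [exact Hz|now apply pow_le].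
  - intros l Hl; rewrite gaussian_term_S.
    apply Rmult_le_compat_r; [now apply gaussian_term_nonneg|].
    apply Rmult_le_compat_l; [exact Hz|now apply pow_le_decr].
Qed.

Lemma ex_series_gaussian_lt_1 (zeta m : R) :
  (0 <= zeta)%R -> (0 <= m < 1)%R -> ex_series (gaussian_term zeta m).
Proof.
  intros Hz Hm.
  assert (Hl : is_lim_seq (fun n => zeta * m ^ n)%R 0%R).
  { replace (Finite 0) with (Rbar_mult zeta 0%R) by (simpl; f_equal; ring).
    apply is_lim_seq_scal_l, is_lim_seq_geom; rewrite Rabs_pos_eq; lra. }
  apply is_lim_seq_spec in Hl.
  destruct (Hl (mkposreal 1 Rlt_0_1)) as [L HL].
  specialize (HL L (Nat.le_refl L)); simpl in HL; rewrite Rminus_0_r in HL.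
  apply ex_series_gaussian_of_ratio with L; [exact Hz|lra|].
  now apply Rle_lt_trans with (2 := HL), Rle_abs.
Qed.

Lemma gaussian_term_not_to_0 (zeta m : R) (L : nat) :
  (0 < zeta)%R -> (0 < m)%R ->
  (forall l, (L <= l)%nat -> (1 <= zeta * m ^ l)%R) ->
  ~ is_lim_seq (gaussian_term zeta m) 0%R.
Proof.
  intros Hz Hm Hstep Hlim; set (y := gaussian_term zeta m) in *.
  assert (Hpos : forall l, (0 < y l)%R)
    by (intros l; now apply gaussian_term_pos).
  assert (Hge : forall n, (y L <= y (n + L)%nat)%R).
  { induction n as [|n IH]; [simpl; lra|].
    apply Rle_trans with (1 := IH); simpl Nat.add.
    assert (E := gaussian_term_S zeta m (n + L)); fold y in E; rewrite E.
    assert (H1 := Hstep (n + L)%nat ltac:(lia)).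
    specialize (Hpos (n + L)%nat); nra. }
  apply (is_lim_seq_incr_n y L) in Hlim.
  assert (H := is_lim_seq_le (fun _ => y L) _ (y L) 0%R Hge
                 (is_lim_seq_const _) Hlim).
  specialize (Hpos L); simpl in H; lra.
Qed.

(** The ratio of consecutive terms is [zeta m^l].  For [m < 1] it tends to zero;
    for [m = 1] the series is geometric; for [m > 1] the ratio becomes at least
    [1] unless [zeta = 0], so the terms cannot tend to zero. *)
Lemma ex_series_gaussian_of_lim (zeta m : R) :
  (0 <= zeta)%R -> (0 < m)%R ->
  is_lim_seq (gaussian_term zeta m) 0%R -> ex_series (gaussian_term zeta m).
Proof.
  intros [Hz|Hz] Hm Hlim.
  2: { apply ex_series_ratio with 0%R O; [|lra|].
       - intros l; apply gaussian_term_nonneg; lra.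
       - intros l _; rewrite gaussian_term_S, <- Hz; lra. }
  destruct (Rlt_le_dec m 1) as [Hm1|[Hm1|Hm1]].
  - apply ex_series_gaussian_lt_1; lra.
  - exfalso.
    destruct (Pow_x_infinity m) with (b := (/ zeta)%R) as [L HL].
    { rewrite Rabs_pos_eq; lra. }
    apply (gaussian_term_not_to_0 zeta m L Hz Hm); [|exact Hlim].
    intros l Hl; specialize (HL l Hl).
    rewrite Rabs_pos_eq in HL by (apply pow_le; lra).
    replace 1%R with (zeta * / zeta)%R by (field; lra).
    apply Rmult_le_compat_l; lra.
  - subst m; destruct (Rlt_le_dec zeta 1) as [Hz1|Hz1].
    + apply ex_series_gaussian_of_ratio with O; simpl; lra.
    + exfalso; apply (gaussian_term_not_to_0 zeta 1 O Hz Hm); [|exact Hlim].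
      intros l _; rewrite pow1; lra.
Qed.

(** * Absolute convergence of the basic hypergeometric series *)

Lemma Czpow_mult (x y : C) (k : Z) :
  x <> 0 -> y <> 0 -> Czpow (x * y) k = Czpow x k * Czpow y k.
Proof.
  intros Hx Hy; destruct k; simpl; [ring|apply Cpow_mult_l|].
  rewrite Cpow_mult_l; field; split; now apply Cpow_nz.
Qed.

Lemma Czpow_neq_0 (x : C) (k : Z) : x <> 0 -> Czpow x k <> 0.
Proof.
  intros Hx; destruct k; simpl; [apply C1_nz|now apply Cpow_nz|].
  rewrite <- Cpow_inv by exact Hx; apply Cpow_nz.
  intros E; apply C1_nz; rewrite <- (Cinv_r x Hx), E; ring.
Qed.

Lemma Czpow_pow (x : C) (n : nat) (k : Z) :
  x <> 0 -> Czpow (x ^ n) k = Czpow x k ^ n.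
Proof.
  intros Hx; induction n as [|n IH].
  - destruct k; simpl; rewrite ?Cpow_1_l; try reflexivity; field.
  - rewrite !Cpow_S, Czpow_mult, IH; auto using Cpow_nz.
Qed.

Lemma Czpow_mult_nat (x : C) (k : Z) (n : nat) :
  x <> 0 -> Czpow x (k * Z.of_nat n) = Czpow x k ^ n.
Proof.
  intros Hx; destruct n as [|n].
  - rewrite Z.mul_0_r; reflexivity.
  - destruct k as [|p|p]; simpl Z.mul; unfold Czpow.
    + symmetry; apply Cpow_1_l.
    + rewrite Pos2Nat.inj_mul, SuccNat2Pos.id_succ; apply Cpow_mult_r.
    + rewrite Pos2Nat.inj_mul, SuccNat2Pos.id_succ, Cpow_mult_r.
      symmetry; apply Cpow_inv; now apply Cpow_nz.
Qed.

Lemma minus_1_neq_0 : RtoC (-1) <> 0.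
Proof. intros E; apply RtoC_inj in E; lra. Qed.

Lemma is_lim_seq_Cmod_terms (u : nat -> C) :
  Cconverges u -> is_lim_seq (fun n => Cmod (u n)) 0%R.
Proof.
  intros [l Hl]; apply is_series_tends_to in Hl.
  set (s := fun n => @sum_n C_AbelianMonoid u n) in Hl.
  apply (is_lim_seq_incr_1 (fun n => Cmod (u n))).
  apply is_lim_seq_0_le with (fun n => Cmod (s (S n) - l) + Cmod (s n - l))%R.
  - intros n; split; [apply Cmod_ge_0|].
    rewrite <- (Cmod_opp (s n - l)).
    eapply Rle_trans; [|apply Cmod_triangle].
    apply Req_le; f_equal; unfold s; rewrite sum_Sn.
    change (plus ?x ?y) with (x + y); ring.
  - replace (Finite 0) with (Finite (0 + 0)) by (f_equal; ring).
    apply is_lim_seq_plus'; [|exact Hl].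
    now apply (is_lim_seq_incr_1 (fun n => Cmod (s n - l))).
Qed.

Lemma Cprod_bounded (f : nat -> nat -> C) (r : nat) :
  (forall i, (i < r)%nat -> exists c K : R, (0 < c)%R /\
     forall l, (c <= Cmod (f i l) <= K)%R) ->
  exists c K : R, (0 < c)%R /\
    forall l, (c <= Cmod (Cprod (fun i => f i l) r) <= K)%R.
Proof.
  induction r as [|r IH]; intros H.
  - exists 1%R, 1%R; split; [lra|]; intros l; simpl; rewrite Cmod_1; lra.
  - destruct IH as [c [K [Hc HcK]]]; [auto|].
    destruct (H r) as [c' [K' [Hc' HcK']]]; [auto|].
    exists (c * c')%R, (K * K')%R; split; [now apply Rmult_lt_0_compat|].
    intros l; simpl; rewrite Cmod_mult.
    specialize (HcK l); specialize (HcK' l).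
    split; apply Rmult_le_compat; try apply Cmod_ge_0; lra.
Qed.

Lemma qpoch_bounded (a q : C) :
  (Cmod q < 1)%R -> (forall l, a * q ^ l <> 1) ->
  exists c K : R, (0 < c)%R /\ forall n, (c <= Cmod (qpoch a q n) <= K)%R.
Proof.
  intros Hq Ha; destruct (qpoch_bounded_below a q Hq Ha) as [c [Hc Hn]].
  exists c, (exp (Cmod a / (1 - Cmod q))); split; [exact Hc|].
  intros n; split; [apply Hn|now apply Cmod_qpoch_le].
Qed.

Lemma Cdiv_bounded (f g : nat -> C) (c K c' K' : R) :
  (0 < c)%R -> (forall l, (c <= Cmod (f l) <= K)%R) ->
  (0 < c')%R -> (forall l, (c' <= Cmod (g l) <= K')%R) ->
  exists c'' K'' : R, (0 < c'')%R /\
    forall l, (c'' <= Cmod (f l / g l) <= K'')%R.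
Proof.
  intros Hc Hf Hc' Hg.
  assert (HK' : (0 < K')%R) by (specialize (Hg O); lra).
  exists (c * / K')%R, (K * / c')%R; split.
  { apply Rmult_lt_0_compat; [exact Hc|now apply Rinv_0_lt_compat]. }
  intros l; specialize (Hf l); specialize (Hg l).
  rewrite Cmod_div by (apply Cmod_gt_0; lra).
  split; apply Rmult_le_compat; try lra.
  - now apply Rlt_le, Rinv_0_lt_compat.
  - apply Rinv_le_contravar; lra.
  - apply Rlt_le, Rinv_0_lt_compat; lra.
  - apply Rinv_le_contravar; lra.
Qed.

(** The part of the Phi term that stays bounded and bounded away from zero. *)
Definition Phi_ratio (q : C) (r s : nat) (a b : nat -> C) (l : nat) : C :=
  pochratio q r s a b l / qpoch q q l.

Lemma Phi_ratio_bounded (q : C) (r s : nat) (a b : nat -> C) :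
  (Cmod q < 1)%R ->
  (forall i l : nat, (i < r)%nat -> a i * q ^ l <> 1) ->
  (forall j l : nat, (j < s)%nat -> b j * q ^ l <> 1) ->
  exists c K : R, (0 < c)%R /\
    forall l, (c <= Cmod (Phi_ratio q r s a b l) <= K)%R.
Proof.
  intros Hq Ha Hb.
  destruct (Cprod_bounded (fun i l => qpoch (a i) q l) r)
    as [c1 [K1 [Hc1 H1]]].
  { intros i Hi; apply qpoch_bounded; auto. }
  destruct (Cprod_bounded (fun j l => qpoch (b j) q l) s)
    as [c2 [K2 [Hc2 H2]]].
  { intros j Hj; apply qpoch_bounded; auto. }
  destruct (Cdiv_bounded _ _ _ _ _ _ Hc1 H1 Hc2 H2) as [c3 [K3 [Hc3 H3]]].
  destruct (qpoch_bounded q q Hq) as [c4 [K4 [Hc4 H4]]].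
  { intros l; now apply Cmod_lt_1_neq, Cmod_lt_1_pow. }
  exact (Cdiv_bounded _ _ _ _ _ _ Hc3 H3 Hc4 H4).
Qed.

Lemma Phi_term_eq (q : C) (r s : nat) (a b : nat -> C) (x : C) (l : nat) :
  q <> 0 ->
  Phi_term q r s a b x l
  = Phi_ratio q r s a b l
    * ((x * Czpow (-1) (excess r s)) ^ l
       * Czpow q (excess r s) ^ (l * (l - 1) / 2)).
Proof.
  intros Hq; unfold Phi_term, Phi_ratio.
  rewrite Czpow_mult, !Czpow_pow, Cpow_mult_l;
    auto using Cpow_nz, minus_1_neq_0.
  unfold Cdiv; ring.
Qed.

Lemma Cmod_Phi_term (q : C) (r s : nat) (a b : nat -> C) (x : C) (l : nat) :
  q <> 0 ->
  Cmod (Phi_term q r s a b x l)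
  = (Cmod (Phi_ratio q r s a b l)
     * gaussian_term (Cmod (x * Czpow (-1) (excess r s)))
         (Cmod (Czpow q (excess r s))) l)%R.
Proof.
  intros Hq; rewrite Phi_term_eq by exact Hq.
  unfold gaussian_term; now rewrite !(Cmod_mult _ (_ * _)), Cmod_mult, !Cmod_pow.
Qed.

(** Convergence alone forces absolute convergence; in particular the balanced
    case [r = s + 1] has no conditional convergence on the unit circle, since
    there the terms do not tend to zero. *)
Lemma Phi_abs_converges (q : C) (r s : nat) (a b : nat -> C) (x : C) :
  (0 < Cmod q)%R -> (Cmod q < 1)%R ->
  (forall i l : nat, (i < r)%nat -> a i * q ^ l <> 1) ->
  (forall j l : nat, (j < s)%nat -> b j * q ^ l <> 1) ->
  Cconverges (Phi_term q r s a b x) ->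
  ex_series (fun l => Cmod (Phi_term q r s a b x l)).
Proof.
  intros Hq0 Hq Ha Hb Hconv; apply Cmod_gt_0 in Hq0.
  destruct (Phi_ratio_bounded q r s a b Hq Ha Hb) as [c [K [Hc HcK]]].
  set (zeta := Cmod (x * Czpow (-1) (excess r s))).
  set (m := Cmod (Czpow q (excess r s))).
  assert (Hm : (0 < m)%R) by now apply Cmod_gt_0, Czpow_neq_0.
  assert (Hz : (0 <= zeta)%R) by apply Cmod_ge_0.
  assert (Hg : forall l, (0 <= gaussian_term zeta m l)%R)
    by (intros l; apply gaussian_term_nonneg; lra).
  assert (Hterm : forall l, Cmod (Phi_term q r s a b x l)
            = (Cmod (Phi_ratio q r s a b l) * gaussian_term zeta m l)%R)
    by (intros l; now apply Cmod_Phi_term).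
  assert (Hsum : ex_series (gaussian_term zeta m)).
  { apply ex_series_gaussian_of_lim; try assumption.
    apply is_lim_seq_0_le with
      (fun l => / c * Cmod (Phi_term q r s a b x l))%R.
    - intros l; split; [apply Hg|].
      rewrite Hterm, <- Rmult_assoc.
      rewrite <- (Rmult_1_l (gaussian_term zeta m l)) at 1.
      apply Rmult_le_compat_r; [apply Hg|].
      replace 1%R with (/ c * c)%R by (field; lra).
      apply Rmult_le_compat_l; [|apply HcK].
      now apply Rlt_le, Rinv_0_lt_compat.
    - replace (Finite 0) with (Rbar_mult (/ c)%R 0%R)
        by (simpl; f_equal; ring).
      now apply is_lim_seq_scal_l, is_lim_seq_Cmod_terms. }
  apply (ex_series_le (V := R_CompleteNormedModule) _
           (fun l => K * gaussian_term zeta m l)%R).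
  - intros l; change (Rabs (Cmod (Phi_term q r s a b x l))
                      <= K * gaussian_term zeta m l)%R.
    rewrite Rabs_pos_eq, Hterm by apply Cmod_ge_0.
    apply Rmult_le_compat_r; [apply Hg|apply HcK].
  - exact (ex_series_scal (V := R_NormedModule) _ _ Hsum).
Qed.

(** * The transform of the R function *)

Lemma cpow_affine (Lg : C -> C) (u x y : C) (l : nat) :
  cpow Lg u (INR l * x + y) = cpow Lg u x ^ l * cpow Lg u y.
Proof. now rewrite cpow_plus, cpow_INR. Qed.

Lemma geometric_bounded_le_1 (x y : C) (c : R) :
  y <> 0 -> (forall l, (Cmod (x ^ l * y) < c)%R) -> (Cmod x <= 1)%R.
Proof.
  intros Hy H; apply Cmod_gt_0 in Hy.
  destruct (Rle_lt_dec (Cmod x) 1) as [Hx|Hx]; [exact Hx|exfalso].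
  destruct (Pow_x_infinity (Cmod x)) with (b := (c / Cmod y)%R) as [L HL].
  { rewrite Rabs_pos_eq; lra. }
  specialize (HL L (Nat.le_refl L)); specialize (H L).
  rewrite Rabs_pos_eq in HL by (apply pow_le, Cmod_ge_0).
  rewrite Cmod_mult, Cmod_pow in H.
  apply Rge_le in HL.
  apply (Rmult_le_compat_r (Cmod y)) in HL; [|lra].
  unfold Rdiv in HL; rewrite Rmult_assoc, Rinv_l in HL; lra.
Qed.

(** The node [w q^n] enters only through the factor [(q^alpha)^(l n)], and
    [1 / Gamma_q] contributes [(p_l;q)_oo]; up to a constant, what is left is
    the Phi term, whose argument absorbs the powers [(1-q)^(alpha l)] and
    [w^(alpha l)]. *)
Lemma Rq_term_eq (Lg : C -> C) (q w alpha beta z : C) (r s : nat)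
    (a b : nat -> C) (n l : nat) :
  q <> 0 -> (Cmod q < 1)%R -> branch_on_lattice Lg q w ->
  Rq_term Lg q r s a b alpha beta (z * cpow Lg (w * q ^ n) alpha) l
  = cpow Lg (1 - q) (beta - 1) / qpoch_inf q q
    * (Phi_term q r s a b (z * cpow Lg (1 - q) alpha * cpow Lg w alpha) l
       * qpoch_inf (cpow Lg q (INR l * alpha + beta)) q
       * (cpow Lg q alpha ^ l) ^ n).
Proof.
  intros Hq0 Hq Hlat; unfold Rq_term, Phi_term.
  rewrite inv_qGamma, cpow_lattice by assumption.
  replace (INR l * alpha + beta - 1) with (INR l * alpha + (beta - 1)) by ring.
  rewrite (cpow_affine Lg (1 - q)).
  rewrite Czpow_mult, !Czpow_pow, !Czpow_mult_nat;
    auto using Cpow_nz, minus_1_neq_0.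
  rewrite <- Cpow_mult_r, (Nat.mul_comm l n), Cpow_mult_r, !Cpow_mult_l.
  unfold Cdiv; ring.
Qed.

Lemma sumudu_Rq (q : C) (Lg : C -> C) (r s : nat) (a b : nat -> C)
    (alpha beta z w : C) :
  (0 < Cmod q)%R -> (Cmod q < 1)%R -> log_branch Lg -> w <> 0 ->
  branch_on_lattice Lg q w ->
  (forall i l : nat, (i < r)%nat -> a i * q ^ l <> 1) ->
  (forall j l : nat, (j < s)%nat -> b j * q ^ l <> 1) ->
  (forall l : nat, (Cmod (cpow Lg q (INR l * alpha + beta)) < 1)%R) ->
  Cconverges (Phi_term q r s a b
    (z * cpow Lg (1 - q) alpha * cpow Lg w alpha)) ->
  (forall n : nat, Cconverges (Rq_term Lg q r s a b alpha beta
    (z * cpow Lg (w * q ^ n) alpha))) /\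
  sumudu_converges q
    (fun t => cpow Lg t (beta - 1)
              * Rq Lg q r s a b alpha beta (z * cpow Lg t alpha)) w /\
  sumudu q
    (fun t => cpow Lg t (beta - 1)
              * Rq Lg q r s a b alpha beta (z * cpow Lg t alpha)) w
  = cpow Lg w (beta - 1) * cpow Lg (1 - q) (beta - 1)
    * Phi q r s a b (z * cpow Lg (1 - q) alpha * cpow Lg w alpha).
Proof.
  intros Hq0 Hq HLg Hw Hlat Ha Hb Hp Hconv.
  assert (Habs := Phi_abs_converges q r s a b _ Hq0 Hq Ha Hb Hconv).
  assert (Hqnz : q <> 0) by now apply Cmod_gt_0.
  set (Phil := Phi_term q r s a b
                 (z * cpow Lg (1 - q) alpha * cpow Lg w alpha)) in *.
  set (A := cpow Lg q alpha); set (B := cpow Lg q beta).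
  set (p := fun l : nat => cpow Lg q (INR l * alpha + beta)).
  assert (Hp1 : forall l, (Cmod (p l) < 1)%R) by exact Hp.
  assert (HpAB : forall l, p l = A ^ l * B)
    by (intros l; apply cpow_affine).
  assert (HA : (Cmod A <= 1)%R).
  { apply geometric_bounded_le_1 with B 1%R; [apply cpow_neq_0|].
    intros l; rewrite <- HpAB; apply Hp1. }
  assert (HAl : forall l n, (Cmod ((A ^ l) ^ n) <= 1)%R)
    by (intros l n; now apply Cmod_pow_le_1, Cmod_pow_le_1).
  assert (HB : (Cmod B < 1)%R).
  { replace B with (p O); [apply Hp1|rewrite HpAB; simpl; ring]. }
  set (K := exp (1 / (1 - Cmod q))).
  assert (HK : forall l, (Cmod (qpoch_inf (p l) q) <= K)%R)
    by (intros l; apply Cmod_qpoch_inf_le; [exact Hq|now apply Rlt_le]).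
  destruct (inv_qqn_bounded q Hq) as [K' [HK' HqK']].
  set (c := cpow Lg (1 - q) (beta - 1) / qpoch_inf q q).
  (* the inner series at the node w q^n, up to the constant c *)
  assert (Hinner : forall n, Cconverges
            (fun l => Phil l * qpoch_inf (p l) q * (A ^ l) ^ n)).
  { intros n; apply Cconverges_dominated with (fun l => Cmod (Phil l) * K)%R.
    - intros l; rewrite !Cmod_mult.
      apply Rle_trans with (Cmod (Phil l) * K * 1)%R; [|lra].
      apply Rmult_le_compat; try apply Cmod_ge_0; [| |apply HAl].
      + apply Rmult_le_pos; apply Cmod_ge_0.
      + apply Rmult_le_compat_l; [apply Cmod_ge_0|apply HK].
    - now apply ex_series_scal_r. }
  set (G := fun n => CSeries
              (fun l => Phil l * qpoch_inf (p l) q * (A ^ l) ^ n)).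
  assert (HG : forall n, Cis_series
            (fun l => Phil l * qpoch_inf (p l) q * (A ^ l) ^ n) (G n))
    by (intros n; apply CSeries_correct, Hinner).
  assert (HRq : forall n, Cis_series (Rq_term Lg q r s a b alpha beta
            (z * cpow Lg (w * q ^ n) alpha)) (c * G n)).
  { intros n; apply is_series_ext with (2 := is_series_Cscal c _ _ (HG n)).
    intros l; symmetry; now apply Rq_term_eq. }
  split; [intros n; exists (c * G n); apply HRq|].
  assert (Hdouble : Cis_series (fun n => B ^ n / qpoch q q n * G n)
                      (CSeries Phil)).
  { apply is_series_exchange with
      (a := fun n l => B ^ n / qpoch q q n
                       * (Phil l * qpoch_inf (p l) q * (A ^ l) ^ n))
      (u := fun l => (Cmod (Phil l) * K)%R)
      (v := fun n => (K' * Cmod B ^ n)%R).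
    - now apply ex_series_scal_r.
    - exact (ex_series_scal (V := R_NormedModule) _ _
               (ex_series_geom_Cmod B HB)).
    - intros n l; unfold Cdiv; rewrite !Cmod_mult, (Cmod_pow B).
      rewrite Rmult_comm; apply Rmult_le_compat.
      + repeat apply Rmult_le_pos; apply Cmod_ge_0.
      + apply Rmult_le_pos; [apply pow_le|]; apply Cmod_ge_0.
      + apply Rle_trans with (Cmod (Phil l) * K * 1)%R; [|lra].
        apply Rmult_le_compat; try apply Cmod_ge_0; [| |apply HAl].
        * apply Rmult_le_pos; apply Cmod_ge_0.
        * apply Rmult_le_compat_l; [apply Cmod_ge_0|apply HK].
      + rewrite Rmult_comm.
        apply Rmult_le_compat_r; [apply pow_le, Cmod_ge_0|apply HqK'].
    - intros l.
      assert (Hnz := qpoch_inf_neq_0_disc (p l) q Hq (Hp1 l)).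
      assert (HE := is_series_Cscal (Phil l * qpoch_inf (p l) q) _ _
                      (euler_identity q (p l) Hq (Hp1 l))).
      replace (Phil l * qpoch_inf (p l) q * / qpoch_inf (p l) q)
        with (Phil l) in HE by (field; exact Hnz).
      apply is_series_ext with (2 := HE); intros n.
      match goal with |- ?x = ?y => change (@eq C x y) end.
      rewrite HpAB at 2; rewrite Cpow_mult_l; unfold Cdiv; ring.
    - intros n; apply is_series_Cscal, HG. }
  apply sumudu_is_series; try assumption.
  assert (Hqq := qpoch_inf_neq_0_disc q q Hq Hq).
  replace (cpow Lg w (beta - 1) * cpow Lg (1 - q) (beta - 1)
           * Phi q r s a b (z * cpow Lg (1 - q) alpha * cpow Lg w alpha))
    with (cpow Lg w (beta - 1) * c * qpoch_inf q q * CSeries Phil)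
    by (unfold c, Phi, Phil; field; exact Hqq).
  apply is_series_ext with (2 := is_series_Cscal _ _ _ Hdouble).
  intros n; unfold Rq; rewrite (CSeries_unique _ _ (HRq n)).
  rewrite cpow_lattice, qpoch_inf_shift by assumption.
  replace B with (cpow Lg q (beta - 1) * q).
  2: { unfold B; rewrite <- (cpow_1 Lg q HLg Hqnz) at 2.
       rewrite <- cpow_plus; f_equal; ring. }
  rewrite Cpow_mult_l; unfold Cdiv.
  match goal with |- ?x = ?y => change (@eq C x y) end; ring.
Qed.

(** * The transform on the class A *)

Lemma qfact_qpoch (q : C) (n : nat) :
  (Cmod q < 1)%R -> qfact q n = qpoch q q n / (1 - q) ^ n.
Proof.
  intros Hq; assert (H := one_minus_neq_0 q Hq).
  induction n as [|n IH]; [unfold qfact, qpoch; simpl; field|].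
  change (qfact q (S n)) with (qfact q n * ((1 - q ^ S n) / (1 - q))).
  rewrite IH, qpoch_S, !Cpow_S; field; split; auto using Cpow_nz.
Qed.

(** The terms are of Gaussian type with ratio parameter [|q| < 1], so the series
    is dominated on the whole interval by its majorant at [T]. *)
Lemma qExp_bounded (q : C) (T : R) :
  (Cmod q < 1)%R -> (0 <= T)%R ->
  exists K : R, forall t : R, (0 <= t <= T)%R -> (Cmod (qExp q (RtoC t)) <= K)%R.
Proof.
  intros Hq HT; destruct (inv_qqn_bounded q Hq) as [K [HK Hn]].
  set (g := gaussian_term (Cmod (1 - q) * T) (Cmod q)).
  assert (Hex : ex_series (fun n => K * g n)%R).
  { apply (ex_series_scal (V := R_NormedModule)), ex_series_gaussian_lt_1.
    - apply Rmult_le_pos; [apply Cmod_ge_0|exact HT].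
    - split; [apply Cmod_ge_0|exact Hq]. }
  exists (Series (fun n => K * g n)%R); intros t Ht.
  assert (Hdom : forall n, (Cmod (q ^ (n * (n - 1) / 2) / qfact q n
                                  * RtoC t ^ n) <= K * g n)%R).
  { intros n.
    replace (q ^ (n * (n - 1) / 2) / qfact q n * RtoC t ^ n)
      with (/ qpoch q q n * (((1 - q) * RtoC t) ^ n * q ^ (n * (n - 1) / 2))).
    - rewrite !Cmod_mult, !Cmod_pow, Cmod_mult, Cmod_R, Rabs_pos_eq by lra.
      apply Rmult_le_compat; [apply Cmod_ge_0| |apply Hn|].
      + apply Rmult_le_pos; apply pow_le; [|apply Cmod_ge_0].
        apply Rmult_le_pos; [apply Cmod_ge_0|lra].
      + apply Rmult_le_compat_r; [apply pow_le, Cmod_ge_0|].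
        apply pow_incr; split.
        * apply Rmult_le_pos; [apply Cmod_ge_0|lra].
        * apply Rmult_le_compat_l; [apply Cmod_ge_0|lra].
    - rewrite qfact_qpoch, Cpow_mult_l by exact Hq.
      assert (H1 := qpoch_neq_0_disc q q n Hq Hq).
      assert (H2 := Cpow_nz _ n (one_minus_neq_0 q Hq)).
      field; auto. }
  apply (Cmod_series_le _ _ _
           (CSeries_correct _ (Cconverges_dominated _ _ Hdom Hex)) Hdom Hex).
Qed.

(** All the nodes [x q^n] lie between [-|x|] and [|x|], on alternating sides of
    the origin when [q < 0], so both constants of the class may be involved;
    dividing by the smaller one bounds the arguments of [qExp] on either side. *)
Lemma sumudu_class_converges (q : C) (f : C -> C) (tau1 tau2 x : R) :
  (Cmod q < 1)%R -> snd q = 0%R -> sumudu_class q f tau1 tau2 ->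
  x <> 0%R -> sumudu_converges q f x.
Proof.
  intros Hq Hreal [Ht1 [Ht2 [M [HM Hf]]]] Hx.
  set (tau := Rmin tau1 tau2).
  assert (Htau : (0 < tau)%R) by now apply Rmin_glb_lt.
  assert (Hscale : forall y tau', (Rabs y <= Rabs x)%R -> (tau <= tau')%R ->
            (0 <= Rabs y / tau' <= Rabs x / tau)%R).
  { intros y tau' Hy Htau'; split.
    - apply Rcomplements.Rdiv_le_0_compat; [apply Rabs_pos|lra].
    - apply Rmult_le_compat; [apply Rabs_pos| |exact Hy|].
      + apply Rlt_le, Rinv_0_lt_compat; lra.
      + apply Rinv_le_contravar; lra. }
  destruct (qExp_bounded q (Rabs x / tau) Hq) as [K HK].
  { apply Rcomplements.Rdiv_le_0_compat; [apply Rabs_pos|exact Htau]. }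
  assert (Hbound : forall y : R, (Rabs y <= Rabs x)%R ->
            (Cmod (f y) <= M * K)%R).
  { intros y Hy; destruct (Hf y) as [Hneg Hpos].
    destruct (Rle_lt_dec y 0) as [Hy0|Hy0].
    - eapply Rle_trans; [apply Rlt_le, Hneg, Hy0|].
      apply Rmult_le_compat_l; [lra|apply HK, Hscale; [exact Hy|apply Rmin_l]].
    - eapply Rle_trans; [apply Rlt_le, Hpos; lra|].
      apply Rmult_le_compat_l; [lra|apply HK, Hscale; [exact Hy|apply Rmin_r]]. }
  apply Cconverges_dominated with
    (fun n => (M * K * exp (1 / (1 - Cmod q))) * Cmod q ^ n)%R.
  - intros n; rewrite sumudu_term_eq by (intros E; apply Hx, RtoC_inj, E).
    assert (Hxn : RtoC x * q ^ n = RtoC (x * fst q ^ n)).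
    { rewrite RtoC_mult, RtoC_pow; do 2 f_equal.
      destruct q as [q1 q2]; simpl in *; now rewrite Hreal. }
    assert (Hqn := Cmod_pow_le_1 q n (Rlt_le _ _ Hq)).
    rewrite !Cmod_mult, Cmod_pow, Rmult_comm.
    apply Rmult_le_compat_r; [apply pow_le, Cmod_ge_0|].
    apply Rmult_le_compat; try apply Cmod_ge_0.
    + rewrite Hxn; apply Hbound; rewrite <- !Cmod_R, <- Hxn, Cmod_mult.
      apply Rle_trans with (Cmod x * 1)%R; [|lra].
      apply Rmult_le_compat_l; [apply Cmod_ge_0|exact Hqn].
    + apply Cmod_qpoch_inf_le; [exact Hq|].
      now apply Rlt_le, Cmod_lt_1_pow.
  - exact (ex_series_scal (V := R_NormedModule) _ _
             (ex_series_geom_Cmod q Hq)).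
Qed.

Theorem theorem13 (q : C) (Lg : C -> C) (r s : nat) (a b : nat -> C)
    (alpha beta z w : C)
    (hq0 : (0 < Cmod q)%R) (hq1 : (Cmod q < 1)%R)
    (hLg : log_branch Lg)
    (hw : w <> 0) (hlat : branch_on_lattice Lg q w)
    (hr : (1 <= r)%nat) (hs : (1 <= s)%nat)
    (ha : forall i l : nat, (i < r)%nat -> a i * q ^ l <> 1)
    (hb : forall j l : nat, (j < s)%nat -> b j * q ^ l <> 1) :
  (* the transform of the R function *)
  ((forall l : nat, (Cmod (cpow Lg q (INR l * alpha + beta)) < 1)%R) ->
   Cconverges (Phi_term q r s a b
     (z * cpow Lg (1 - q) alpha * cpow Lg w alpha)) ->
   (forall n : nat, Cconverges (Rq_term Lg q r s a b alpha beta
     (z * cpow Lg (w * q ^ n) alpha))) /\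
   sumudu_converges q
     (fun t => cpow Lg t (beta - 1)
               * Rq Lg q r s a b alpha beta (z * cpow Lg t alpha)) w /\
   sumudu q
     (fun t => cpow Lg t (beta - 1)
               * Rq Lg q r s a b alpha beta (z * cpow Lg t alpha)) w
   = cpow Lg w (beta - 1) * cpow Lg (1 - q) (beta - 1)
     * Phi q r s a b (z * cpow Lg (1 - q) alpha * cpow Lg w alpha)) /\
  (* the two forms of the transform *)
  (forall f : C -> C,
     sumudu q f w
     = / (1 - q) * jackson q (fun t => f (w * t) * qpoch_inf (q * t) q) 1) /\
  (* the transform of powers *)
  (forall lambda : C, (Cmod (cpow Lg q lambda) < 1)%R ->
     sumudu_converges q (fun t => cpow Lg t (lambda - 1)) w /\
     sumudu q (fun t => cpow Lg t (lambda - 1)) w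
     = cpow Lg w (lambda - 1) * cpow Lg (1 - q) (lambda - 1)
       * qGamma Lg q lambda) /\
  (* the transform is defined on the class A *)
  (snd q = 0%R ->
   forall (f : C -> C) (tau1 tau2 x : R),
     sumudu_class q f tau1 tau2 ->
     (- tau1 < x < tau2)%R -> x <> 0%R ->
     sumudu_converges q f x).
Proof.
  split; [|split; [|split]].
  - now apply sumudu_Rq.
  - intros f; now apply sumudu_unit_interval.
  - intros lambda; now apply sumudu_power.
  - intros Hreal f tau1 tau2 x Hf _ Hx.
    now apply (sumudu_class_converges q f tau1 tau2).
Qed.
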